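(* Let $X_1,X_2,\ldots$ be i.i.d. random variables with $0\le X_i\le 1$ and mean $\mu\in(0,1)$. Let $\delta\in(0,1)$, $\varepsilon\in(0,\tfrac12)$, let $s$ be a positive integer, let $m_1<m_2<\cdots<m_s$ be positive integers with $m_s\ge \frac{\ln(2s/\delta)}{2\varepsilon^2}$, and let $\mathcal{N}$ be a set of positive integers containing $\{m_1,\ldots,m_s\}$. Let $\overline{X}_n=\frac1n\sum_{i=1}^n X_i$. Let $\mathbf{n}$ be the smallest $n\in\mathcal{N}$ for which there exists $\ell\in\{1,\ldots,s\}$ such that $$M_{\mathrm B}\left(\tfrac12-\left|\tfrac12-\overline{X}_n\right|+\varepsilon-\frac{n\varepsilon}{n\vee m_\ell},\ \tfrac12-\left|\tfrac12-\overline{X}_n\right|+\varepsilon\right)\le \frac{1}{m_\ell}\ln\frac{\delta}{2s}.$$ Then $\Pr\{|\overline{X}_{\mathbf n}-\mu|<\varepsilon\}\ge 1-\delta$.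
   Context: $a\vee b$ denotes $\max(a,b)$. The function $M_{\mathrm B}$ is defined by: $M_{\mathrm B}(z,\theta)=z\ln\frac{\theta}{z}+(1-z)\ln\frac{1-\theta}{1-z}$ for $z\in(0,1)$, $\theta\in(0,1)$; $M_{\mathrm B}(0,\theta)=\ln(1-\theta)$ and $M_{\mathrm B}(1,\theta)=\ln\theta$ for $\theta\in(0,1)$; $M_{\mathrm B}(z,\theta)=-\infty$ for every real $z$ and $\theta\notin(0,1)$. The random index $\mathbf n$ is the sample number at termination of the sampling procedure ''continue sampling until the displayed condition holds for some $n\in\mathcal N$ and some $\ell$''. *)

(* Defs.v *)
From HB Require Import structures.
From mathcomp Require Import all_boot all_order all_algebra.
From mathcomp Require Import all_classical all_reals all_analysis.

Set Implicit Arguments.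
Unset Strict Implicit.
Unset Printing Implicit Defensive.

Import Order.TTheory GRing.Theory Num.Theory.
Import numFieldNormedType.Exports.

Local Open Scope classical_set_scope.
Local Open Scope ring_scope.

Section iid.
Context {d : measure_display} {T : measurableType d} {R : realType}.
Variable P : probability T R.

Definition mutually_independent (X : nat -> {RV P >-> R}) : Prop :=
  forall (I : seq nat) (A : nat -> set R), uniq I ->
    (forall i, i \in I -> measurable (A i)) ->
    (P (\bigcap_(i in [set j | j \in I]) (X i @^-1` A i)) =
     \prod_(i <- I) P (X i @^-1` A i))%E.

Definition identically_distributed (X : nat -> {RV P >-> R}) : Prop :=
  forall (i j : nat) (A : set R), measurable A ->
    distribution P (X i) A = distribution P (X j) A.

Definition iid (X : nat -> {RV P >-> R}) : Prop :=
  mutually_independent X /\ identically_distributed X.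

(* The observations are indexed from 0: [X i] is the (i+1)-st one. *)
Definition sample_mean (X : nat -> {RV P >-> R}) (n : nat) (w : T) : R :=
  n%:R^-1 * \sum_(i < n) X i w.

End iid.

(* For 0 < theta < 1 the function is specified only for z in [0, 1]; the value
   +oo outside is arbitrary and is never used by the stopping rule below when
   the observations lie in [0, 1] and 0 < eps < 1/2. *)
Definition M_B {R : realType} (z theta : R) : \bar R :=
  if (0 < theta) && (theta < 1) then
    if z == 0 then (ln (1 - theta))%:E
    else if z == 1 then (ln theta)%:E
    else if (0 < z) && (z < 1) then
      (z * ln (theta / z) + (1 - z) * ln ((1 - theta) / (1 - z)))%:E
    else +oo%E
  else -oo%E.

Section stopping.
Context {R : realType}.
Variables (eps delta : R) (s : nat) (m : nat -> nat).

Definition stopping_condition (n : nat) (x : R) : Prop :=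
  exists2 l : nat, (1 <= l <= s)%N &
    (M_B (2^-1 - `|2^-1 - x| + eps - n%:R * eps / (maxn n (m l))%:R)%R
         (2^-1 - `|2^-1 - x| + eps)%R
     <= ((m l)%:R^-1 * ln (delta / (2 * s%:R)))%:E)%E.

(* [xbar n] is the value of the sample mean after n observations. *)
Definition is_termination_index (N : set nat) (xbar : nat -> R) (n : nat) :
    Prop :=
  [/\ N n, stopping_condition n (xbar n) &
      forall k, N k -> stopping_condition k (xbar k) -> (n <= k)%N].

End stopping.

(* Main.v *)
Require Import Defs.
From HB Require Import structures.
From mathcomp Require Import all_boot all_order all_algebra.
From mathcomp Require Import all_classical all_reals all_analysis.
From mathcomp Require Import measurable_realfun.
From mathcomp Require Import ring lra.

(** Let [kl] be the relative entropy of Bernoulli laws, so that [M_B = - kl],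
    and put [a = n / max(n, m_l)].  If the rule stops at [n] through [l] while
    the sample mean [x] satisfies [x + eps <= mu], then joint convexity of [kl]
    (comparing the pair at distance [eps] from [x] with the one at distance
    [mu - x]) gives [ln (2 s / delta) / m_l <= kl (mu - a (mu - x)) mu]; when
    [x > 1/2] one first reflects [x] around [1/2], which increases [kl].
    Betting a constant fraction [lam] on the [X i - mu] yields the nonnegative
    martingale [\prod_(i < n) (1 + lam (X i - mu))].  One choice of [lam],
    valid for all [n] simultaneously, makes it exceed [2 s / delta] whenever the
    above inequality holds, so by Ville's inequality this has probability at
    most [delta / (2 s)].  The other tail follows by replacing [X] with
    [1 - X], and the union over [l] and both tails costs [delta].  Sampling
    stops by time [m_s] thanks to Pinsker's inequality. *)

Set Implicit Arguments.
Unset Strict Implicit.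
Unset Printing Implicit Defensive.

Import Order.TTheory GRing.Theory Num.Theory.
Import numFieldNormedType.Exports.

Local Open Scope classical_set_scope.
Local Open Scope ring_scope.

(** * Relative entropy of Bernoulli laws *)

Section bernoulli_kl.
Context {R : realType}.
Implicit Types a b p q r t u x z theta h : R.

Lemma ln_le_sub1 x : 0 < x -> ln x <= x - 1.
Proof.
move=> x0; have := @le_ln1Dx R (x - 1).
by rewrite addrCA subrr addr0 => ->//; lra.
Qed.

(** Variational bound: for fixed [r] the left side is linear in [(p, q)], and it is tight at
    [r = p / q]. It follows from [ln y <= y - 1] at [y = r / (p / q)]. *)
Lemma mulr_ln_ge p q r : 0 <= p -> 0 < q -> 0 < r ->
  p * ln r + p - q * r <= p * ln (p / q).
Proof.
rewrite le_eqVlt => /predU1P[<- q0 r0|p0 q0 r0].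
  by rewrite !mul0r !add0r oppr_le0 mulr_ge0// ltW.
have := @ln_le_sub1 (r / (p / q)).
rewrite !divr_gt0// => /(_ isT).
rewrite ln_div ?posrE ?divr_gt0// => le1.
have : p * (ln r - ln (p / q)) <= p * (r / (p / q) - 1) by rewrite ler_pM2l.
have -> : p * (r / (p / q) - 1) = q * r - p.
  by field; rewrite gt_eqF//= gt_eqF.
by rewrite mulrBr; lra.
Qed.

(** Log-sum inequality for the pairs [(p, q)] and [(x, x)], the second of which contributes
    [x * ln 1 = 0]. *)
Lemma mulr_ln_mix p q x a : 0 <= p -> 0 < q -> 0 <= x -> 0 < a <= 1 ->
  (a * p + (1 - a) * x) * ln ((a * p + (1 - a) * x) / (a * q + (1 - a) * x))
  <= a * (p * ln (p / q)).
Proof.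
move=> p0 q0 x0 /andP[a0 a1].
set u := a * p + _; set v := a * q + _.
have ap : 0 <= a * p by rewrite mulr_ge0// ltW.
have ax : 0 <= (1 - a) * x by rewrite mulr_ge0// subr_ge0.
have v0 : 0 < v by rewrite ltr_pwDl// mulr_gt0.
have u0 : 0 <= u by rewrite addr_ge0.
have [u_gt0|] := boolP (0 < u); last first.
  rewrite lt_neqAle u0 andbT negbK => /eqP uE.
  have pE : p = 0.
    have /eqP : a * p = 0 by move: uE; rewrite /u; lra.
    by rewrite mulf_eq0 (gt_eqF a0) => /eqP.
  by rewrite -uE pE !mul0r mulr0.
have uv0 : 0 < u / v by rewrite divr_gt0.
(* Both pairs are bounded with the same [r = u / v], the tight choice for the mixture, so the two
   bounds add up to exactly [u * ln (u / v)]. *)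
have H1 : a * (p * ln (u / v) + p - q * (u / v)) <= a * (p * ln (p / q)).
  by rewrite ler_pM2l// mulr_ln_ge.
have H2 : (1 - a) * x * (ln (u / v) + 1 - u / v) <= 0.
  by rewrite mulr_ge0_le0//; have := ln_le_sub1 uv0; lra.
suff : u * ln (u / v) = a * (p * ln (u / v) + p - q * (u / v))
  + (1 - a) * x * (ln (u / v) + 1 - u / v) by lra.
transitivity (u * ln (u / v) + u - v * (u / v)).
  by rewrite [v * _]mulrC divfK ?gt_eqF//; ring.
by rewrite /u /v; ring.
Qed.

(* The value at [z = 0] is right because [0 * ln _ = 0]. *)
Definition kl z theta : R :=
  z * ln (z / theta) + (1 - z) * ln ((1 - z) / (1 - theta)).

Lemma M_B_kl z theta : 0 <= z < 1 -> 0 < theta < 1 ->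
  M_B z theta = (- kl z theta)%:E.
Proof.
move=> /andP[z0 z1] /andP[t0 t1]; rewrite /M_B t0 t1 /=.
have [->|zN0] := eqVneq z 0.
  by rewrite /kl !mul0r add0r subr0 mul1r div1r lnV ?posrE ?opprK// subr_gt0.
have z_gt0 : 0 < z by rewrite lt_neqAle eq_sym zN0.
rewrite lt_eqF// z_gt0 z1 /=; congr (_%:E).
rewrite /kl opprD -!mulrN -!lnV ?posrE ?divr_gt0 ?subr_gt0//.
by rewrite !invf_div.
Qed.

Lemma klN z theta : kl (1 - z) (1 - theta) = kl z theta.
Proof. by rewrite /kl !subKr addrC. Qed.

Lemma kl_refl z : 0 <= z < 1 -> kl z z = 0.
Proof.
move=> /andP[z0 z1]; rewrite /kl (divff (_ : 1 - z != 0)); last first.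
  by rewrite gt_eqF// subr_gt0.
have [->|zN0] := eqVneq z 0; first by rewrite mul0r ln1 mulr0 addr0.
by rewrite divff// ln1 !mulr0 addr0.
Qed.

Lemma kl_ge0 z theta : 0 <= z <= 1 -> 0 < theta < 1 -> 0 <= kl z theta.
Proof.
move=> /andP[z0 z1] /andP[t0 t1].
have := @mulr_ln_ge z theta 1 z0 t0 ltr01.
have := @mulr_ln_ge (1 - z) (1 - theta) 1.
rewrite subr_ge0 subr_gt0 => /(_ z1 t1 ltr01).
by rewrite ln1 /kl; lra.
Qed.

(** Joint convexity against the diagonal pair [(x, x)], of zero entropy: contracting a pair towards
    [x] by [a] shrinks [kl] at least by [a]. *)
Lemma kl_mix z theta x a : 0 <= z <= 1 -> 0 < theta < 1 -> 0 <= x <= 1 ->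
  0 < a <= 1 ->
  kl (a * z + (1 - a) * x) (a * theta + (1 - a) * x) <= a * kl z theta.
Proof.
move=> /andP[z0 z1] /andP[t0 t1] /andP[x0 x1] a01.
rewrite /kl mulrDr lerD//; first exact: mulr_ln_mix.
have -> : 1 - (a * z + (1 - a) * x) = a * (1 - z) + (1 - a) * (1 - x) by ring.
have -> : 1 - (a * theta + (1 - a) * x) = a * (1 - theta) + (1 - a) * (1 - x)
  by ring.
by apply: mulr_ln_mix; rewrite ?subr_ge0 ?subr_gt0.
Qed.

Lemma is_derive_ln_affine a b t : 0 < a + b * t ->
  is_derive t 1 (fun u : R => ln (a + b * u)) (b / (a + b * t)).
Proof.
move=> ab0; have dln := is_derive1_ln ab0.
have dab : is_derive t 1 (fun u : R => a + b * u) b.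
  by apply: is_derive_eq; rewrite /GRing.scale /=; ring.
apply: (@is_derive_eq _ _ _ (@ln R \o (fun u : R => a + b * u))).
by rewrite /GRing.scale /= mulrC.
Qed.

Lemma le_is_derive_ge0 (f g : R -> R) h : 0 <= h ->
  (forall t, 0 <= t <= h -> is_derive t 1 f (g t)) ->
  (forall t, 0 <= t <= h -> 0 <= g t) -> f 0 <= f h.
Proof.
move=> h0 df g0.
have I t : t \in `]0, h[ -> 0 <= t <= h.
  by rewrite in_itv /= => /andP[/ltW -> /ltW ->].
apply: (@ger0_derive1_le_cc R f 0 h); rewrite ?in_itv /= ?lexx ?h0//.
- by move=> t /I /df [].
- by move=> t /I tI; rewrite derive1E; have [_ ->] := df _ tI; exact: g0.
- apply: derivable_within_continuous => t; rewrite in_itv /=.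
  by move=> /df [].
Qed.

(** Cross-entropy of [z] relative to [z + b * u], with the logarithms kept affine in [u] for
    differentiation; [b = 1] and [b = -1] give the two directions. *)
Let cross z b u := - (z * ln (z + b * u) + (1 - z) * ln (1 - z + (- b) * u)).

Lemma is_derive_cross z b t : 0 < z + b * t < 1 ->
  is_derive t 1 (cross z b) (b * (b * t) / ((z + b * t) * (1 - (z + b * t)))).
Proof.
move=> /andP[t0 t1].
have H1 := is_derive_ln_affine t0.
have t1' : 0 < 1 - z + (- b) * t by lra.
have H2 := is_derive_ln_affine t1'.
apply: is_derive_eq; rewrite /GRing.scale /=.
have -> : 1 - z + (- b) * t = 1 - (z + b * t) by ring.
by field; rewrite !gt_eqF//; lra.
Qed.

Lemma kl_cross z b u : 0 < z < 1 -> 0 < z + b * u < 1 ->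
  kl z (z + b * u) = cross z b u - cross z b 0.
Proof.
move=> /andP[z0 z1] /andP[u0 u1].
rewrite /cross /kl !ln_div ?posrE ?subr_gt0// !mulr0 !addr0.
have -> : 1 - z + (- b) * u = 1 - (z + b * u) by ring.
by ring.
Qed.

(** Move the second argument away from the first at unit speed on both sides. At time [t] the
    entropies grow at rate [t / (q * (1 - q))], where the two values of [q] are mirror images around
    [x >= 1/2]; the upper one is farther from [1/2], so its rate is larger. *)
Lemma kl_mirror x b h : 2^-1 <= x -> 0 <= b <= 1 -> 0 <= h -> x + h < 1 ->
  kl (x - b * h) (x - h) <= kl (x + b * h) (x + h).
Proof.
move=> x2 /andP[b0 b1] h0 xh.
have bh0 : 0 <= b * h by rewrite mulr_ge0.
have bhh : b * h <= h by rewrite ler_piMl.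
have -> : x - h = x - b * h + (-1) * (h - b * h) by ring.
have -> : x + h = x + b * h + 1 * (h - b * h) by ring.
rewrite !kl_cross; try lra.
pose f t := cross (x + b * h) 1 t - cross (x - b * h) (-1) t.
pose g z e t : R := e * (e * t) / ((z + e * t) * (1 - (z + e * t))).
suff : f 0 <= f (h - b * h) by rewrite /f; lra.
apply: (@le_is_derive_ge0 _
  (fun t => g (x + b * h) 1 t - g (x - b * h) (-1) t)).
- by rewrite subr_ge0.
- move=> t /andP[t0 th].
  have H1 : is_derive t 1 (cross (x + b * h) 1) (g (x + b * h) 1 t).
    by apply: is_derive_cross; lra.
  have H2 : is_derive t 1 (cross (x - b * h) (-1)) (g (x - b * h) (-1) t).
    by apply: is_derive_cross; lra.
  exact: is_deriveB.
- move=> t /andP[t0 th]; rewrite subr_ge0 /g !mulN1r opprK !mul1r.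
  rewrite ler_wpM2l// lef_pV2 ?posrE; [|by rewrite mulr_gt0//; lra..].
  rewrite -subr_ge0; set y := b * h + t.
  have -> : (x - b * h - t) * (1 - (x - b * h - t)) -
    (x + b * h + t) * (1 - (x + b * h + t)) = 2 * y * (2 * x - 1)
    by rewrite /y; ring.
  by rewrite !mulr_ge0//; rewrite /y; lra.
Qed.

(** The derivative [t / (q * (1 - q))] is at least [4 * t], the derivative of [2 * t ^+ 2], since
    [q * (1 - q) <= 1/4]. *)
Lemma kl_pinsker z h : 0 <= z -> 0 <= h <= 2^-1 -> z + h < 1 ->
  2 * h ^+ 2 <= kl z (z + h).
Proof.
move=> z0 /andP[h0 h2] zh.
(* [kl_cross] requires [0 < z]. At [z = 0] the claim is [- ln (1 - h) >= h >= 2 * h ^+ 2], by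
   [h <= 1/2]. *)
move: z0; rewrite le_eqVlt => /predU1P[<-|z0].
  rewrite /kl mul0r add0r add0r subr0 mul1r div1r lnV ?posrE; last by lra.
  have := @ln_le_sub1 (1 - h).
  have : h * (1 - 2 * h) >= 0 by rewrite mulr_ge0//; lra.
  by rewrite expr2; lra.
rewrite -[in leRHS](mul1r h) kl_cross ?mul1r; try lra.
pose f t := cross z 1 t - 2 * (t * t).
suff : f 0 <= f h by rewrite /f expr2 !mulr0; lra.
apply: (@le_is_derive_ge0 _ (fun t =>
  1 * (1 * t) / ((z + 1 * t) * (1 - (z + 1 * t))) - 4 * t)) => //.
- move=> t /andP[t0 th].
  have H1 : is_derive t 1 (cross z 1)
      (1 * (1 * t) / ((z + 1 * t) * (1 - (z + 1 * t)))).
    by apply: is_derive_cross; lra.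
  by apply: is_derive_eq; rewrite /GRing.scale /=; ring.
- move=> t /andP[t0 th]; rewrite !mul1r subr_ge0 mulrC ler_wpM2l//.
  rewrite -[leLHS]invrK lef_pV2 ?posrE ?invr_gt0//; last first.
    by rewrite mulr_gt0//; lra.
  rewrite -subr_ge0.
  have -> : 4^-1 - (z + t) * (1 - (z + t)) = (z + t - 2^-1) ^+ 2 by field.
  exact: sqr_ge0.
Qed.

End bernoulli_kl.

(** * From the stopping rule to a constant bet *)

Section bernoulli_bets.
Context {R : realType}.
Implicit Types a c eps mu u v x y : R.

Lemma stopped_kl_ge mu eps c a x : 0 < eps < 2^-1 -> mu < 1 -> 0 <= x ->
  x + eps <= mu -> 0 <= a <= 1 ->
  (M_B (2^-1 - `|2^-1 - x| + eps - a * eps)%R (2^-1 - `|2^-1 - x| + eps)%R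
    <= (- c)%:E)%E ->
  c <= kl (mu - a * (mu - x)) mu.
Proof.
move=> /andP[e0 e2] mu1 x0 xmu /andP[a0 a1].
have ae0 : 0 <= a * eps by rewrite mulr_ge0// ltW.
have aee : a * eps <= eps by rewrite ler_piMl// ltW.
move=> stop; apply: (@le_trans _ _ (kl (x + (1 - a) * eps) (x + eps))).
  move: stop; case: (leP x 2^-1) => x2.
    rewrite ger0_norm ?subr_ge0// subKr M_B_kl; try lra.
    rewrite lee_fin lerN2 => /le_trans; apply.
    by rewrite le_eqVlt; apply/predU1P; left; congr kl; ring.
  rewrite ltr0_norm ?subr_lt0// M_B_kl; try lra.
  rewrite lee_fin lerN2 => /le_trans; apply.
  (* The pair is [(1 - x + (1 - a) * eps, 1 - x + eps)]; complementing it gives the lower side of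
     [kl_mirror] with [b = 1 - a] and [h = eps]. *)
  rewrite -klN.
  apply: le_trans (kl_mirror _ _ (ltW e0) _); try lra.
  by rewrite le_eqVlt; apply/predU1P; left; congr kl; field.
have mux : 0 < mu - x by lra.
(* Contraction by [l] towards [x] takes [mu] to [x + eps] and [mu - a * (mu - x)] to
   [x + (1 - a) * eps]. *)
pose l := eps / (mu - x).
have l0 : 0 < l by rewrite divr_gt0.
have l1 : l <= 1 by rewrite ler_pdivrMr// mul1r; lra.
have amu0 : 0 <= a * (mu - x) by rewrite mulr_ge0// ltW.
have amu1 : a * (mu - x) <= mu - x by rewrite ler_piMl// ltW.
have v01 : 0 <= mu - a * (mu - x) <= 1 by lra.
have mu01 : 0 < mu < 1 by lra.
have lE : l * (mu - x) = eps by rewrite divfK ?gt_eqF.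
have -> : x + (1 - a) * eps = l * (mu - a * (mu - x)) + (1 - l) * x.
  by rewrite -lE; ring.
have -> : x + eps = l * mu + (1 - l) * x by rewrite -lE; ring.
apply: le_trans (kl_mix v01 mu01 _ _) _; try lra.
by rewrite ler_piMl// kl_ge0.
Qed.

(** Weighted AM-GM: the tangent to [ln] at the mean [y] bounds both logarithms, and the linear terms
    cancel on averaging. *)
Lemma concave_ln_mix x u0 u1 : 0 <= x <= 1 -> 0 < u0 -> 0 < u1 ->
  expR (x * ln u1 + (1 - x) * ln u0) <= (1 - x) * u0 + x * u1.
Proof.
move=> /andP[x0 x1] u00 u10; set y := leRHS.
have y0 : 0 < y.
  have : 0 <= x * u1 by rewrite mulr_ge0// ltW.
  have : 0 <= (1 - x) * u0 by rewrite mulr_ge0 ?subr_ge0// ltW.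
  rewrite /y; case: (leP x 2^-1) => x2.
    have : 0 < (1 - x) * u0 by rewrite mulr_gt0//; lra.
    by lra.
  have : 0 < x * u1 by rewrite mulr_gt0//; lra.
  by lra.
rewrite -[leRHS](lnK (_ : y \is Num.pos)) ?posrE// ler_expR.
have H u : 0 < u -> ln u <= ln y + u / y - 1.
  move=> u_gt0; have := @ln_le_sub1 _ (u / y).
  by rewrite ln_div ?posrE// divr_gt0// => /(_ isT); lra.
have H1 : x * ln u1 <= x * (ln y + u1 / y - 1) by rewrite ler_wpM2l// H.
have H0 : (1 - x) * ln u0 <= (1 - x) * (ln y + u0 / y - 1).
  by rewrite ler_wpM2l ?subr_ge0// H.
suff -> : ln y = x * (ln y + u1 / y - 1) + (1 - x) * (ln y + u0 / y - 1) by lra.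
transitivity (ln y + y / y - 1); first by rewrite divff ?gt_eqF//; ring.
by rewrite {2}/y; ring.
Qed.

Lemma kl_level mu c v0 : 0 < mu < 1 -> 0 < c -> 0 < v0 < mu -> c <= kl v0 mu ->
  exists2 v1, 0 < v1 < mu & kl v1 mu = c.
Proof.
move=> /andP[mu0 mu1] c0 /andP[v00 v0mu] cv0.
have klmu : kl mu mu = 0 by rewrite kl_refl// ltW.
have [||v1] := @IVT R (fun v => kl v mu) v0 mu c (ltW v0mu).
(* With affine arguments the logarithms are differentiable on the interval, which gives the
   continuity needed for the intermediate value theorem. *)
- pose f v := v * ln (0 + mu^-1 * v) +
    (1 - v) * ln ((1 - mu)^-1 + (- (1 - mu)^-1) * v).
  have -> : (fun v => kl v mu) = f.
    apply/funext => v; rewrite /kl /f; congr (_ * ln _ + _ * ln _).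
      by rewrite add0r mulrC.
    by ring.
  apply: derivable_within_continuous => v; rewrite in_itv /= => /andP[v0v vmu].
  have p1 : 0 < 0 + mu^-1 * v by rewrite add0r mulr_gt0 ?invr_gt0//; lra.
  have p2 : 0 < (1 - mu)^-1 + (- (1 - mu)^-1) * v.
    rewrite mulNr -mulrN -[X in X + _]mulr1 -mulrDr.
    by rewrite mulr_gt0 ?invr_gt0//; lra.
  have H1 := is_derive_ln_affine p1; have H2 := is_derive_ln_affine p2.
  exact: ex_derive.
- rewrite /= klmu min_r ?max_l; try lra.
rewrite in_itv /= => /andP[v0v1 v1mu] kl1; exists v1 => //.
rewrite (lt_le_trans v00 v0v1) lt_neqAle v1mu andbT.
by apply: contraPneq kl1 => ->; rewrite klmu => /eqP; rewrite lt_eqF.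
Qed.

(* The bet [lam] may not depend on [n]: it is the log-optimal one for the
   mean [v1 < mu] with [kl v1 mu = c], or for [0] if there is none. *)
Lemma betting_coefficient mu c (m : nat) : 0 < mu < 1 -> 0 < c ->
  exists2 lam : R, (forall x, 0 <= x <= 1 -> 0 <= 1 + lam * (x - mu)) &
  forall (n : nat) (xs : nat -> R) (x a : R), (0 < n)%N ->
    (forall i, 0 <= xs i <= 1) -> x = n%:R^-1 * \sum_(i < n) xs i ->
    a = n%:R / (maxn n m)%:R -> x < mu ->
    c <= kl (mu - a * (mu - x)) mu ->
    expR (m%:R * c) <= \prod_(i < n) (1 + lam * (xs i - mu)).
Proof.
move=> /andP[mu0 mu1] c0.
have afacts (n : nat) a : (0 < n)%N -> a = n%:R / (maxn n m)%:R ->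
    [/\ 0 < a, a <= 1 & a * (maxn n m)%:R = n%:R].
  move=> n0 ->; have M0 : 0 < (maxn n m)%:R :> R.
    by rewrite ltr0n leq_max n0.
  split; first by rewrite divr_gt0// ltr0n.
    by rewrite ler_pdivrMr// mul1r ler_nat leq_maxl.
  by rewrite divfK// gt_eqF.
have [[v0 v0mu cv0]|noV] := pselect (exists2 v, 0 < v < mu & c <= kl v mu).
  have [v1 /andP[v10 v1mu] klv1] : exists2 v1, 0 < v1 < mu & kl v1 mu = c.
    by apply: kl_level cv0 => //; rewrite mu0.
  (* Likelihood ratios of the mean [v1] against [mu] at outcomes 1 and 0. The bet [lam] is the one
     whose factor is linear between them, as [lamE] says. *)
  pose u1 := v1 / mu; pose u0 := (1 - v1) / (1 - mu).
  have u10 : 0 < u1 by rewrite divr_gt0.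
  have u00 : 0 < u0 by rewrite divr_gt0//; lra.
  pose lam := (v1 - mu) / (mu * (1 - mu)).
  have lamE x : 1 + lam * (x - mu) = (1 - x) * u0 + x * u1.
    by rewrite /lam /u0 /u1; field; rewrite !gt_eqF//; lra.
  exists lam.
    move=> x /andP[x0 x1]; rewrite lamE addr_ge0// mulr_ge0 ?subr_ge0//;
    exact: ltW.
  move=> n xs x a n0 xs01 xE aE xmu cv.
  have [a0 a1 aM] := afacts _ _ n0 aE.
  (* The log-likelihood ratio. Being affine, it sums to [n * g x] over the sample, and
     [g v1 = kl v1 mu = c]. *)
  pose g y := y * ln u1 + (1 - y) * ln u0.
  have n0R : n%:R != 0 :> R by rewrite pnatr_eq0 -lt0n.
  apply: (@le_trans _ _ (\prod_(i < n) expR (g (xs i)))); last first.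
    apply: ler_prod => i _; rewrite expR_ge0 /= lamE.
    by rewrite concave_ln_mix.
  rewrite -expR_sum ler_expR.
  have -> : \sum_(i < n) g (xs i) = n%:R * g x.
    have sE : \sum_(i < n) xs i = n%:R * x by rewrite xE mulVKf.
    rewrite /g big_split /= -!mulr_suml sumrB sE sumr_const card_ord.
    by ring.
  have x0 : 0 <= x.
    by rewrite xE mulr_ge0 ?invr_ge0// sumr_ge0// => i _; case/andP: (xs01 i).
  set v := mu - a * (mu - x) in cv.
  have ax0 : 0 <= a * x by rewrite mulr_ge0// ltW.
  have amu0 : 0 <= (1 - a) * mu by rewrite mulr_ge0 ?subr_ge0// ltW.
  have vge0 : 0 <= v by rewrite /v; lra.
  have vmu : v < mu by rewrite /v ltrBlDr ltrDl mulr_gt0// subr_gt0.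
  (* If [v1 < v < mu], then [v] is a strict contraction of [v1] towards [mu], so
     [kl v mu <= l * c < c], a contradiction. *)
  have vv1 : v <= v1.
    rewrite leNgt; apply/negP => v1v.
    pose l := (mu - v) / (mu - v1).
    have lE : l * (mu - v1) = mu - v by rewrite divfK// gt_eqF// subr_gt0.
    have l0 : 0 < l by rewrite divr_gt0// subr_gt0.
    have l1 : l < 1 by rewrite ltr_pdivrMr ?subr_gt0// mul1r; lra.
    have := @kl_mix _ v1 mu mu l.
    have -> : l * v1 + (1 - l) * mu = v.
      by apply: (addIr (- mu)); rewrite -(opprK (v - mu)) opprB -lE; ring.
    have -> : l * mu + (1 - l) * mu = mu by ring.
    rewrite klv1 => /(_ _ _ _ _)/(le_trans cv) H.
    have : c <= l * c by apply: H; lra.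
    by rewrite leNgt gtr_pMl ?l1.
  (* [g mu] is [- kl mu v1]. *)
  have gmu : g mu <= 0.
    have H1 : mu * ln u1 <= mu * (u1 - 1) by rewrite ler_pM2l// ln_le_sub1.
    have H0 : (1 - mu) * ln u0 <= (1 - mu) * (u0 - 1).
      by rewrite ler_pM2l ?subr_gt0// ln_le_sub1.
    suff : mu * (u1 - 1) + (1 - mu) * (u0 - 1) = 0 by rewrite /g; lra.
    by rewrite /u1 /u0; field; rewrite !gt_eqF//; lra.
  (* [g] is nonincreasing because [u1 <= 1 <= u0]. *)
  have gv : c <= g v.
    rewrite -klv1 -/(g v1) -subr_ge0.
    have -> : g v - g v1 = (v1 - v) * (ln u0 - ln u1) by rewrite /g; ring.
    rewrite mulr_ge0 ?subr_ge0//; apply: (@le_trans _ _ 0).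
      by rewrite ln_le0// ler_pdivrMr// mul1r ltW.
    by rewrite ln_ge0// ler_pdivlMr ?subr_gt0// mul1r; lra.
  (* [v] is the mixture of [mu] and [x] with weights [1 - a] and [a]. Since [a * maxn n m = n], this
     bound yields [m * c <= n * g x]. *)
  have gx : c <= a * g x.
    have : g v = (1 - a) * g mu + a * g x by rewrite /g /v; ring.
    have : (1 - a) * g mu <= 0 by rewrite mulr_ge0_le0 ?subr_ge0.
    by lra.
  rewrite -aM mulrAC mulrC; apply: ler_pM => //; first exact: ltW.
  by rewrite ler_nat leq_maxr.
exists (- (1 - mu)^-1).
  move=> x /andP[x0 x1].
  have -> : 1 + - (1 - mu)^-1 * (x - mu) = (1 - x) / (1 - mu).
    by field; rewrite gt_eqF//; lra.
  by rewrite divr_ge0//; lra.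
move=> n xs x a n0 xs01 xE aE xmu cv.
have [a0 a1 aM] := afacts _ _ n0 aE.
have sum0 : 0 <= \sum_(i < n) xs i.
  by rewrite sumr_ge0// => i _; case/andP: (xs01 i).
have x0 : 0 <= x by rewrite xE mulr_ge0 ?invr_ge0.
set v := mu - a * (mu - x) in cv.
have ax0 : 0 <= a * x by rewrite mulr_ge0// ltW.
have amu0 : 0 <= (1 - a) * mu by rewrite mulr_ge0 ?subr_ge0// ltW.
have vmu : v < mu by rewrite /v ltrBlDr ltrDl mulr_gt0// subr_gt0.
(* No point of [(0, mu)] reaches level [c], so [v = 0]. This forces [x = 0] and [a = 1], that is,
   only zeros observed and [m <= n]; every factor is then [(1 - mu)^-1], whose logarithm is
   [kl 0 mu >= c]. *)
have v0 : v = 0.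
  apply/eqP; rewrite eq_le; apply/andP; split; last by rewrite /v; lra.
  rewrite leNgt; apply/negP => v0; apply: noV; exists v => //.
  by rewrite v0.
have /eqP : a * x = 0 by move: v0; rewrite /v; lra.
rewrite mulf_eq0 (gt_eqF a0) /= => /eqP x00.
have /eqP : (1 - a) * mu = 0 by move: v0; rewrite /v x00; lra.
rewrite mulf_eq0 (gt_eqF mu0) orbF subr_eq0 => /eqP a1E.
have mn : (m <= n)%N.
  move: aM; rewrite -a1E mul1r => /eqP.
  by rewrite eqr_nat => /eqP <-; exact: leq_maxr.
have xs0 (i : 'I_n) : xs i = 0.
  have : \sum_(i < n) xs i == 0.
    move/esym/eqP : xE; rewrite x00 mulf_eq0 invr_eq0 pnatr_eq0.
    by rewrite eqn0Ngt n0.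
  rewrite psumr_eq0 => [/allP/(_ i)|j _]; last by case/andP: (xs01 j).
  by rewrite mem_index_enum => /(_ isT)/eqP.
under eq_bigr => i _.
  have -> : 1 + - (1 - mu)^-1 * (xs i - mu) = (1 - mu)^-1.
    by rewrite xs0; field; rewrite gt_eqF//; lra.
  over.
have mu_inv : 0 < (1 - mu)^-1 by rewrite invr_gt0 subr_gt0.
rewrite prodr_const card_ord.
rewrite -[X in _ <= X ^+ _](lnK (_ : _ \is Num.pos)) ?posrE//.
rewrite -expRM_natl ler_expR.
apply: ler_pM => //; rewrite ?ler_nat//; first exact: ltW.
by move: cv; rewrite v0 /kl mul0r add0r subr0 mul1r div1r.
Qed.

End bernoulli_bets.

(** * Independence of an observation from the past *)

Section independence.
Context {d : measure_display} {T : measurableType d} {R : realType}.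
Variable P : probability T R.

(** The joint law agrees with the product of the marginals on rectangles, hence everywhere, and
    Tonelli's theorem factors the integral. *)
Lemma integral_mul_independent (U V : T -> R) :
  measurable_fun setT U -> measurable_fun setT V ->
  (forall w, 0 <= U w) -> (forall w, 0 <= V w) ->
  (forall A B : set R, measurable A -> measurable B ->
    P (U @^-1` A `&` V @^-1` B) = P (U @^-1` A) * P (V @^-1` B))%E ->
  (\int[P]_w (U w * V w)%:E = \int[P]_w (U w)%:E * \int[P]_w (V w)%:E)%E.
Proof.
move=> mU mV U0 V0 UV.
pose U' : {mfun T >-> R} := HB.pack U (isMeasurableFun.Build _ _ _ _ U mU).
pose V' : {mfun T >-> R} := HB.pack V (isMeasurableFun.Build _ _ _ _ V mV).
have mUV : measurable_fun setT (fun w => (U w, V w)).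
  exact: measurable_fun_pair.
pose UV' : {mfun T >-> (R * R)%type} :=
  HB.pack (fun w => (U w, V w)) (isMeasurableFun.Build _ _ _ _ _ mUV).
pose PU := distribution P U'; pose PV := distribution P V'.
(* Tonelli needs a function nonnegative on all of [R]; on the values of [U] and [V] the absolute
   value is the identity. *)
pose g (x : R) : \bar R := (`|x|)%:E.
have mg : measurable_fun [set: R] g.
  by apply/measurable_EFinP; exact: normr_measurable.
have g0 x : (0 <= g x)%E by rewrite lee_fin.
pose f (z : R * R) : \bar R := (g z.1 * g z.2)%E.
have mf : measurable_fun [set: R * R] f.
  by apply: emeasurable_funM; apply: measurableT_comp.
have f0 z : (0 <= f z)%E by rewrite mule_ge0.
have EU : (\int[P]_w (U w)%:E = \int[PU]_x g x)%E.
  rewrite ge0_integral_distribution//.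
  by apply: eq_integral => w _ /=; rewrite /g /= ger0_norm.
have EV : (\int[P]_w (V w)%:E = \int[PV]_x g x)%E.
  rewrite ge0_integral_distribution//.
  by apply: eq_integral => w _ /=; rewrite /g /= ger0_norm.
transitivity (\int[distribution P UV']_z f z)%E.
  rewrite ge0_integral_distribution//.
  by apply: eq_integral => w _ /=; rewrite /f /g /= !ger0_norm.
transitivity (\int[(PU \x PV)%E]_z f z)%E.
  apply: eq_measure_integral => C mC _.
  apply/esym; exact: product_measure_unique.
rewrite fubini_tonelli1// EU EV -ge0_integralZr//; last first.
  by apply: integral_ge0.
by apply: eq_integral => x _; rewrite /fubini_F /f /= ge0_integralZl.
Qed.

Variable X : nat -> {RV P >-> R}.

(** A family closed under intersection that generates the sigma-algebra of the first [k]
    observations, indexed by a list to match [mutually_independent]. *)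
Definition past_cylinders (k : nat) : set (set T) :=
  [set B | exists2 A : nat -> set R, (forall i, measurable (A i)) &
    B = \bigcap_(i in [set j | j \in iota 0 k]) (X i @^-1` A i)].

Lemma past_cylinders_measurable k : past_cylinders k `<=` measurable.
Proof.
move=> _ [A mA ->]; apply: bigcap_measurableType => i _.
exact: measurable_funPTI.
Qed.

(** Both sides are finite measures in [B]; they agree on the cylinders, hence on the sigma-algebra
    these generate. *)
Lemma past_independent k B A : mutually_independent X ->
  <<s past_cylinders k >> B -> measurable A ->
  (P (B `&` X k @^-1` A) = P B * P (X k @^-1` A))%E.
Proof.
move=> Xind GB mA.
set C := X k @^-1` A.
have mC : measurable C by exact: measurable_funPTI.
have PC0 : 0 <= fine (P C) by rewrite fine_ge0.
pose m2 := mscale (NngNum PC0) P.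
have m2E D : m2 D = (P D * P C)%E.
  by rewrite /m2 /mscale /= fineK ?fin_num_measure// muleC.
rewrite -m2E.
apply: (@g_sigma_algebra_measure_unique _ R T (past_cylinders k)
  (@past_cylinders_measurable k) (fun=> setT) _ _ (mrestr P mC) m2) => //.
- move=> _; exists (fun=> setT) => //.
  by apply/seteqP; split.
- by rewrite bigcup_const.
- move=> _ _ [A1 mA1 ->] [A2 mA2 ->]; exists (fun i => A1 i `&` A2 i).
    by move=> i; exact: measurableI.
  rewrite -bigcapI; apply: eq_bigcapr => i _.
  by rewrite preimage_setI.
- move=> _ [A' mA' ->]; rewrite [RHS]m2E /= /mrestr.
  pose A2 i := if i == k then A else A' i.
  have A2k i : i \in iota 0 k -> A2 i = A' i.
    by rewrite mem_iota /A2 => /andP[_ ik]; rewrite ltn_eqF.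
  have := Xind (rcons (iota 0 k) k) A2.
  rewrite rcons_uniq mem_iota add0n ltnn iota_uniq => /(_ isT).
  have mA2 i : measurable (A2 i) by rewrite /A2; case: ifP.
  move=> /(_ (fun i _ => mA2 i)) H2.
  have := Xind (iota 0 k) A' (iota_uniq 0 k) (fun i _ => mA' i).
  move=> ->.
  have -> : \bigcap_(i in [set j | j \in iota 0 k]) (X i @^-1` A' i) `&` C =
    \bigcap_(i in [set j | j \in rcons (iota 0 k) k]) (X i @^-1` A2 i).
    apply/seteqP; split => [w [wA wC] i /=|w wA].
      rewrite mem_rcons inE => /predU1P[->|ik]; first by rewrite /A2 eqxx.
      by rewrite A2k//; exact: wA.
    split=> [i /= ik|].
      by rewrite -A2k//; apply: wA; rewrite /= mem_rcons inE ik orbT.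
    have := wA k; rewrite /A2 eqxx; apply.
    by rewrite /= mem_rcons inE eqxx.
  rewrite H2 big_rcons /= /A2 eqxx; congr (_ * _)%E.
  by apply: eq_big_seq => i ik; rewrite -/(A2 i) A2k.
- by move=> _; rewrite /= /mrestr setTI ltey_eq fin_num_measure.
Qed.

End independence.

(** * Products frozen on reaching a level *)

Section stopped_product.
Context {R : realType}.

(** Freezing makes the events of having reached [A] increase with [n], so a bound at each fixed time
    becomes a bound uniform in time. *)
Fixpoint stopped_prod (A : R) (y : nat -> R) (n : nat) : R :=
  if n is n'.+1 then
    let w := stopped_prod A y n' in if A <= w then w else w * y n'
  else 1.

Lemma stopped_prod_ge0 A y n : (forall i, 0 <= y i) -> 0 <= stopped_prod A y n.
Proof.
by move=> y0; elim: n => //= n IH; case: ifP => // _; rewrite mulr_ge0.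
Qed.

Lemma stopped_prod_reached A y n : A <= stopped_prod A y n ->
  A <= stopped_prod A y n.+1.
Proof. by move=> An /=; rewrite An. Qed.

Lemma stopped_prodE A y n :
  A <= stopped_prod A y n \/ stopped_prod A y n = \prod_(i < n) y i.
Proof.
elim: n => [|n [An|IH]]; first by right; rewrite big_ord0.
  by left; exact: stopped_prod_reached.
rewrite /=; case: ifP => [|_]; first by left.
by right; rewrite big_ord_recr /= IH.
Qed.

(** The hypothesis stops at [i < n] so that the sigma-algebra of the first [n] observations is
    covered too. *)
Lemma measurable_stopped_prod (d : measure_display) (T : measurableType d)
    (A : R) (Y : nat -> T -> R) n :
  (forall i, (i < n)%N -> measurable_fun setT (Y i)) ->
  measurable_fun setT (fun w => stopped_prod A (Y ^~ w) n).
Proof.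
elim: n => [|n IH] mY /=; first exact: measurable_cst.
have mW : measurable_fun setT (fun w => stopped_prod A (Y ^~ w) n).
  by apply: IH => i ni; exact/mY/ltnW.
apply: measurable_fun_ifT => //.
  by apply: measurable_fun_ler => //; exact: measurable_cst.
by apply: measurable_funM => //; exact: mY.
Qed.

End stopped_product.

(** * Ville's inequality *)

Section ville.
Context {d : measure_display} {T : measurableType d} {R : realType}.
Variables (P : probability T R) (X : nat -> {RV P >-> R}) (f : R -> R) (A : R).
Hypothesis Xind : mutually_independent X.
Hypothesis mf : measurable_fun setT f.
Hypothesis fX0 : forall i w, 0 <= f (X i w).
Hypothesis fX1 : forall i, (\int[P]_w (f (X i w))%:E = 1)%E.
Hypothesis A_gt0 : 0 < A.

Let W n w := stopped_prod A (fun i => f (X i w)) n.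

Let mW n : measurable_fun setT (W n).
Proof.
apply: measurable_stopped_prod => i _.
by apply: measurableT_comp => //; exact: measurable_funPT.
Qed.

Let W0 n w : 0 <= W n w. Proof. exact: stopped_prod_ge0. Qed.

Let past_measurable n :
  measurable_fun [set: g_sigma_algebraType (past_cylinders X n)] (W n).
Proof.
apply: (@measurable_stopped_prod _ _ (g_sigma_algebraType (past_cylinders X n))
  A (fun i w => f (X i w))) => i ni.
apply: (measurableT_comp mf) => _ B mB; rewrite setTI.
apply: sub_sigma_algebra.
exists (fun j => if j == i then B else setT) => [j|]; first by case: ifP.
apply/seteqP; split => [w wB j _ /=|w /(_ i)].
  by case: ifP => // /eqP ->.
by rewrite /= mem_iota ni eqxx; exact.
Qed.

Let active n w := if A <= W n w then 0 else W n w.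
Let frozen n w := if A <= W n w then W n w else 0.

Let mactive n : measurable_fun setT (active n).
Proof.
apply: measurable_fun_ifT => //.
by apply: measurable_fun_ler => //; exact: measurable_cst.
Qed.

Let mfrozen n : measurable_fun setT (frozen n).
Proof.
apply: measurable_fun_ifT => //.
by apply: measurable_fun_ler => //; exact: measurable_cst.
Qed.

Let active0 n w : 0 <= active n w. Proof. by rewrite /active; case: ifP. Qed.
Let frozen0 n w : 0 <= frozen n w. Proof. by rewrite /frozen; case: ifP. Qed.

Let mfX i : measurable_fun setT (fun w => f (X i w)).
Proof. by apply: measurableT_comp => //; exact: measurable_funPT. Qed.

(** [active n] is a function of the first [n] observations, hence independent of the factor
    [f (X n)], which has mean 1. *)
Let integral_active n :
  (\int[P]_w (active n w * f (X n w))%:E = \int[P]_w (active n w)%:E)%E.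
Proof.
rewrite (@integral_mul_independent _ _ _ P (active n) (fun w => f (X n w)))//.
  by rewrite fX1 mule1.
move=> B C mB mC.
have -> : (fun w => f (X n w)) @^-1` C = X n @^-1` (f @^-1` C) by [].
apply: (past_independent Xind).
  have mact : measurable_fun [set: g_sigma_algebraType (past_cylinders X n)]
      (active n).
    apply: measurable_fun_ifT => //.
    by apply: measurable_fun_ler => //; exact: measurable_cst.
  by have := mact measurableT _ mB; rewrite setTI.
by rewrite -[X in measurable X]setTI; exact: mf.
Qed.

Let integralD_real (F G : T -> R) :
  (forall w, 0 <= F w) -> measurable_fun setT F ->
  (forall w, 0 <= G w) -> measurable_fun setT G ->
  (\int[P]_w (F w + G w)%:E = \int[P]_w (F w)%:E + \int[P]_w (G w)%:E)%E.
Proof.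
move=> F0 mF G0 mG; rewrite -ge0_integralD//.
- by move=> w _; rewrite lee_fin.
- exact/measurable_EFinP.
- by move=> w _; rewrite lee_fin.
- exact/measurable_EFinP.
Qed.

(* [W n.+1 = frozen n + active n * f (X n)], and the new factor has mean 1. *)
Let integral_W n : (\int[P]_w (W n w)%:E = 1)%E.
Proof.
elim: n => [|n IH].
  by rewrite /W /= integral_cst// mul1e; exact: probability_setT.
have WE w : W n.+1 w = frozen n w + active n w * f (X n w).
  by rewrite /W /= /frozen /active /W; case: ifP; rewrite ?mul0r ?addr0 ?add0r.
under eq_integral do rewrite WE.
rewrite integralD_real//; first last.
- exact: measurable_funM.
- by move=> w; rewrite mulr_ge0.
rewrite integral_active -integralD_real// -IH.
apply: eq_integral => w _; congr EFin; rewrite /frozen /active.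
by case: ifP; rewrite ?addr0 ?add0r.
Qed.

Let crossed n := [set w | A <= W n w].

Let mcrossed n : measurable (crossed n).
Proof.
have := emeasurable_fun_c_infty measurableT
  (_ : measurable_fun setT (EFin \o W n)) A%:E.
rewrite setTI; apply.
exact/measurable_EFinP.
Qed.

Let P_crossed n : (P (crossed n) <= A^-1%:E)%E.
Proof.
pose W' : {RV P >-> R} :=
  HB.pack (W n) (isMeasurableFun.Build _ _ _ _ _ (mW n)).
have := @markov _ _ _ P W' idfun A A_gt0 (@measurable_id _ _ _) (fun _ => id)
  (fun _ _ _ _ => id).
rewrite unlock /=.
under eq_integral do rewrite ger0_norm//.
rewrite integral_W => le1.
have -> : crossed n = [set x | (A%:E <= `|(W n x)%:E|)%E].
  by apply/seteqP; split=> w; rewrite /crossed /= lee_fin ger0_norm.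
by rewrite -[leRHS]mule1 lee_pdivlMl.
Qed.

(** Markov's inequality bounds each [crossed n] by [A^-1]; these events increase, so continuity from
    below carries the bound to their union. *)
Lemma ville_inequality : exists B : set T, [/\ measurable B,
  (P B <= A^-1%:E)%E &
  forall n w, A <= \prod_(i < n) f (X i w) -> B w].
Proof.
exists (\bigcup_n crossed n); split.
- exact: bigcup_measurable.
- have cross_homo : {homo crossed : n m / (n <= m)%N >-> (n <= m)%O}.
    apply/nondecreasing_seqP => n; apply/subsetPset => w.
    exact: stopped_prod_reached.
  have /cvg_lim <- // := @nondecreasing_cvg_mu _ _ _ P _ mcrossed
    (bigcup_measurable (fun n _ => mcrossed n)) cross_homo.
  apply: lime_le; last by near=> n; exact: P_crossed.
  apply: ereal_nondecreasing_is_cvgn => n m nm; apply: le_measure.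
  + by rewrite inE.
  + by rewrite inE.
  + by apply/subsetPset; exact: cross_homo.
- move=> n w Aprod; exists n => //; rewrite /crossed /= /W.
  by have [//|->] := stopped_prodE A (fun i => f (X i w)) n.
Unshelve. all: by end_near. Qed.

End ville.

(** * Deviation events and the stopping rule *)

Section deviation.
Context {d : measure_display} {T : measurableType d} {R : realType}.
Variables (P : probability T R) (X : nat -> {RV P >-> R}) (mu eps : R).
Hypothesis Xind : mutually_independent X.
Hypothesis X01 : forall i w, 0 <= X i w <= 1.
Hypothesis X_mean : forall i, ('E_P[X i] = mu%:E)%E.
Hypothesis mu01 : 0 < mu < 1.
Hypothesis eps_bounds : 0 < eps < 2^-1.

Lemma sample_mean01 n w : 0 <= sample_mean X n w <= 1.
Proof.
rewrite /sample_mean; have [->|n0] := posnP n.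
  by rewrite big_ord0 mulr0 lexx ler01.
rewrite mulr_ge0 ?invr_ge0 ?sumr_ge0//=; last first.
  by move=> i _; case/andP: (X01 i w).
rewrite mulrC ler_pdivrMr ?ltr0n// mul1r.
rewrite -[leRHS]mulr1 mulr_natl -[in leRHS](card_ord n) -sumr_const.
by apply: ler_sum => i _; case/andP: (X01 i w).
Qed.

Lemma measurable_sample_mean n : measurable_fun setT (sample_mean X n).
Proof.
apply: measurable_funM; first exact: measurable_cst.
by apply: measurable_sum => i; exact: measurable_funPT.
Qed.

Lemma integral_bet k i : (\int[P]_w (1 + k * (X i w - mu))%:E = 1)%E.
Proof.
have XE : (\int[P]_w (X i w)%:E = mu%:E)%E.
  by rewrite -(X_mean i) expectation_def.
have intX : P.-integrable setT (EFin \o X i).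
  apply/integrableP; split.
    by apply/measurable_EFinP; exact: measurable_funPT.
  under eq_integral => w _.
    rewrite gee0_abs; last by rewrite lee_fin; case/andP: (X01 i w).
    over.
  by rewrite XE ltry.
under eq_integral => w _.
  have -> : 1 + k * (X i w - mu) = (1 - k * mu) + k * X i w by ring.
  rewrite EFinD EFinM.
  over.
rewrite integralD//; last 2 first.
- exact: (finite_measure_integrable_cst P).
- exact: integrableZl.
rewrite integralZl// XE integral_cst//.
rewrite [X in (_ * X)%E](_ : _ = 1)%E ?mule1; last exact: probability_setT.
by rewrite -EFinM -EFinD; congr EFin; ring.
Qed.

(** Treats both tails at once: [b = true] is the upper tail, turned into a lower one by
    reflection. *)
Definition reflect_if (b : bool) (x : R) : R := if b then 1 - x else x.

Lemma deviation_event (b : bool) (m : nat) (A : R) : (0 < m)%N -> 1 < A ->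
  exists B : set T, [/\ measurable B, (P B <= A^-1%:E)%E &
    forall n w, (0 < n)%N ->
      reflect_if b (sample_mean X n w) + eps <= reflect_if b mu ->
      (M_B (2^-1 - `|2^-1 - sample_mean X n w| + eps
              - n%:R * eps / (maxn n m)%:R)%R
           (2^-1 - `|2^-1 - sample_mean X n w| + eps)%R
        <= (- (m%:R^-1 * ln A))%:E)%E -> B w].
Proof.
move=> m0 A1; case/andP: mu01 => mu0 mu1; case/andP: (eps_bounds) => e0 e2.
have mR : m%:R != 0 :> R by rewrite pnatr_eq0 -lt0n.
have c0 : 0 < m%:R^-1 * ln A by rewrite mulr_gt0 ?invr_gt0 ?ltr0n// ln_gt0.
have rmu01 : 0 < reflect_if b mu < 1 by rewrite /reflect_if; case: (b); lra.
have [lam lam0 lamP] := betting_coefficient m rmu01 c0.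
(* Reflection flips the sign of [x - mu], so betting [lam] on reflected observations is betting [k]
   on the original ones, and Ville's inequality applies to [X] itself. *)
pose k := if b then - lam else lam.
have kE x : lam * (reflect_if b x - reflect_if b mu) = k * (x - mu).
  by rewrite /k /reflect_if; case: (b); ring.
have [||||B [mB PB HB]] := @ville_inequality _ _ _ P X
  (fun x => 1 + k * (x - mu)) A Xind.
- apply: measurable_funD; first exact: measurable_cst.
  apply: measurable_funM; first exact: measurable_cst.
  by apply: measurable_funB; [exact: measurable_id|exact: measurable_cst].
- move=> i w; rewrite -kE lam0// /reflect_if.
  by case: (b) (X01 i w) => /andP[? ?]; lra.
- by move=> i; exact: integral_bet.
- by lra.
exists B; split => // n w n0 dev stop; apply: (HB n).
have nR : n%:R != 0 :> R by rewrite pnatr_eq0 -lt0n.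
set x := sample_mean X n w in dev stop.
have /andP[x0 x1] : 0 <= x <= 1 by exact: sample_mean01.
under eq_bigr do rewrite -kE.
rewrite -[leLHS](lnK (_ : A \is Num.pos)) ?posrE; last by lra.
rewrite -[ln A](mulVKf mR) -mulrC -mulrC.
pose a : R := n%:R / (maxn n m)%:R.
have M0 : 0 < (maxn n m)%:R :> R by rewrite ltr0n leq_max n0.
apply: (lamP n (fun i => reflect_if b (X i w)) (reflect_if b x) a) => //.
- by move=> i; rewrite /reflect_if; case: (b) (X01 i w) => /andP[? ?]; lra.
- rewrite /reflect_if; case: (b) => //.
  by rewrite sumrB sumr_const card_ord mulrBr mulVf.
- by lra.
apply: (stopped_kl_ge eps_bounds) => //.
- by case/andP: rmu01.
- by rewrite /reflect_if; case: (b); lra.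
- by rewrite divr_ge0//= ler_pdivrMr// mul1r ler_nat leq_maxl.
have -> : `|2^-1 - reflect_if b x| = `|2^-1 - x|.
  rewrite /reflect_if; case: (b) => //.
  by rewrite -normrN; congr `|_|; field.
by rewrite [a * eps]mulrAC.
Qed.

Variables (delta : R) (s : nat) (m : nat -> nat).

Lemma measurable_stopping_event n : (0 < n)%N ->
  measurable [set w | stopping_condition eps delta s m n (sample_mean X n w)].
Proof.
move=> n0; case/andP: (eps_bounds) => e0 e2.
have -> : [set w | stopping_condition eps delta s m n (sample_mean X n w)] =
  \bigcup_(l in [set l | (1 <= l <= s)%N]) [set w |
    (M_B (2^-1 - `|2^-1 - sample_mean X n w| + eps
              - n%:R * eps / (maxn n (m l))%:R)%R
           (2^-1 - `|2^-1 - sample_mean X n w| + eps)%R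
     <= ((m l)%:R^-1 * ln (delta / (2 * s%:R)))%:E)%E].
  by [].
apply: bigcup_measurable => l _.
set t := n%:R * eps / _.
have t0 : 0 <= t by rewrite !mulr_ge0 ?invr_ge0// ltW.
have te : t <= eps.
  have M0 : 0 < (maxn n (m l))%:R :> R by rewrite ltr0n leq_max n0.
  by rewrite ler_pdivrMr// mulrC ler_pM2l// ler_nat leq_maxl.
pose th w := 2^-1 - `|2^-1 - sample_mean X n w| + eps.
pose z w := th w - t.
have th_bounds w : eps <= th w <= 2^-1 + eps.
  have := sample_mean01 n w; rewrite /th; case: ler0P; lra.
(* [kl] with its quotients split, so that measurability follows termwise. At [z w = 0] the split is
   harmless because of the factor 0. *)
pose F w := - (z w * (ln (z w) - ln (th w))
  + (1 - z w) * (ln (1 - z w) - ln (1 - th w))).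
have ME w : M_B (z w) (th w) = (F w)%:E.
  have /andP[th1 th2] := th_bounds w.
  rewrite M_B_kl; [|by rewrite /z; lra..].
  congr (- _)%:E; rewrite /kl.
  rewrite [ln ((1 - z w) / _)]ln_div ?posrE; [|by rewrite /z; lra..].
  have [z0|z0] := eqVneq (z w) 0; first by rewrite z0 !mul0r.
  rewrite ln_div ?posrE//; last by lra.
  by rewrite lt_neqAle eq_sym z0 /z; lra.
have mth : measurable_fun setT th.
  apply: measurable_funD; last exact: measurable_cst.
  apply: measurable_funB; first exact: measurable_cst.
  apply: measurableT_comp; first exact: normr_measurable.
  apply: measurable_funB; first exact: measurable_cst.
  exact: measurable_sample_mean.
have mz : measurable_fun setT z.
  by apply: measurable_funB => //; exact: measurable_cst.
have m1 (g : T -> R) : measurable_fun setT g ->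
    measurable_fun setT (fun w => 1 - g w).
  by move=> mg; apply: measurable_funB => //; exact: measurable_cst.
have mln (g : T -> R) : measurable_fun setT g ->
    measurable_fun setT (fun w => ln (g w)).
  by move=> mg; apply: measurableT_comp => //; exact: measurable_ln.
have mF : measurable_fun setT F.
  apply: measurable_funN; apply: measurable_funD.
    by apply: measurable_funM => //; apply: measurable_funB; exact: mln.
  apply: measurable_funM; first exact: m1.
  by apply: measurable_funB; apply: mln; exact: m1.
have := emeasurable_fun_infty_c measurableT
  (_ : measurable_fun setT (EFin \o F))
  ((m l)%:R^-1 * ln (delta / (2 * s%:R)))%:E.
rewrite setTI; under eq_set do rewrite /= -ME.
by apply; exact/measurable_EFinP.
Qed.

(** At [n = m s] and [l = s] the two arguments of [M_B] differ by exactly [eps], so [kl_pinsker]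
    gives entropy at least [2 * eps ^+ 2]. *)
Lemma stopping_condition_last x : 0 <= x <= 1 -> (0 < s)%N -> 0 < delta ->
  (0 < m s)%N -> ln (2 * s%:R / delta) / (2 * eps ^+ 2) <= (m s)%:R ->
  stopping_condition eps delta s m (m s) x.
Proof.
move=> x01 s0 delta0 ms0 ms_large; case/andP: (eps_bounds) => e0 e2.
exists s; first by rewrite s0 leqnn.
have mR : 0 < (m s)%:R :> R by rewrite ltr0n.
rewrite maxnn mulrAC divff ?gt_eqF// mul1r addrK.
have w2 : 0 <= 2^-1 - `|2^-1 - x| <= 2^-1 by case: ler0P; lra.
set w := 2^-1 - _ in w2 *.
rewrite M_B_kl; [|by lra..].
have s0R : 0 < 2 * s%:R :> R by rewrite mulr_gt0 ?ltr0n.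
rewrite lee_fin -[delta / _]invf_div lnV ?posrE ?divr_gt0// mulrN lerN2.
apply: (@le_trans _ _ (2 * eps ^+ 2)); last by apply: kl_pinsker; lra.
rewrite [leLHS]mulrC ler_pdivrMr// -ler_pdivrMl; first by rewrite [leLHS]mulrC.
by rewrite mulr_gt0// exprn_gt0.
Qed.

End deviation.

(** * Termination and union bound *)

Theorem mainTheorem1 (R : realType) (d : measure_display)
    (T : measurableType d) (P : probability T R) (X : nat -> {RV P >-> R})
    (mu delta eps : R) (s : nat) (m : nat -> nat) (N : set nat)
    (X_iid : iid X)
    (X_bounded : forall (i : nat) (w : T), 0 <= X i w <= 1)
    (X_mean : forall i : nat, ('E_P[X i] = mu%:E)%E)
    (mu01 : 0 < mu < 1)
    (delta01 : 0 < delta < 1)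
    (eps_bounds : 0 < eps < 2^-1)
    (s_gt0 : (0 < s)%N)
    (m_gt0 : forall l : nat, (1 <= l <= s)%N -> (0 < m l)%N)
    (m_incr : forall k l : nat, (1 <= k)%N -> (k < l)%N -> (l <= s)%N ->
      (m k < m l)%N)
    (m_s_large : ln (2 * s%:R / delta) / (2 * eps ^+ 2) <= (m s)%:R)
    (N_gt0 : forall n : nat, N n -> (0 < n)%N)
    (m_in_N : forall l : nat, (1 <= l <= s)%N -> N (m l)) :
  ((1 - delta)%:E <=
   P [set w : T | exists2 n : nat,
        is_termination_index eps delta s m N (fun k => sample_mean X k w) n &
        `|sample_mean X n w - mu| < eps]%R)%E.
Proof.
case/andP: delta01 => delta0 delta1; case: X_iid => Xind _.
case/andP: (eps_bounds) => e0 e2.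
pose x n w := sample_mean X n w.
have x01 n w : 0 <= x n w <= 1 by exact: sample_mean01.
pose S n := [set w | stopping_condition eps delta s m n (x n w)].
have mS n : N n -> measurable (S n).
  by move=> Nn; apply: measurable_stopping_event => //; exact: N_gt0.
pose D n := [set w | `|x n w - mu| < eps].
have mD n : measurable (D n).
  have := emeasurable_fun_infty_o measurableT
    (_ : measurable_fun setT (EFin \o (fun w => `|x n w - mu|))) eps%:E.
  rewrite setTI; apply; apply/measurable_EFinP.
  apply: measurableT_comp; first exact: normr_measurable.
  apply: measurable_funB; last exact: measurable_cst.
  exact: measurable_sample_mean.
set G := [set w | _].
have mG : measurable G.
  (* Countable decomposition according to the termination index. *)
  have -> : G = \bigcup_(n in N) (S n `&` D n `&`
      \bigcap_(k in [set k | N k /\ (k < n)%N]) ~` S k).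
    apply/seteqP; split => [w [n [Nn Sn minn] Dn]|w [n Nn [[Sn Dn] minn]]].
      exists n => //; split => // k [Nk kn] Sk.
      by have := minn k Nk Sk; rewrite leqNgt kn.
    exists n => //; split => // k Nk Sk; rewrite leqNgt; apply/negP => kn.
    exact: (minn k).
  apply: bigcup_measurable => n Nn.
  apply: measurableI; first by apply: measurableI => //; exact: mS.
  by apply: bigcap_measurableType => k [Nk _]; exact/measurableC/mS.
have sR : 0 < s%:R :> R by rewrite ltr0n.
pose A := 2 * s%:R / delta.
have A1 : 1 < A.
  rewrite ltr_pdivlMr// mul1r (lt_le_trans delta1)//.
  by rewrite -natrM ler1n muln_gt0.
have lnA : ln (delta / (2 * s%:R)) = - ln A.
  by rewrite -invf_div lnV// posrE (lt_trans _ A1).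
(* Here [l] counts from 0 and stands for [m l.+1]. Beyond [s] the event is empty, so that [choice]
   can select one for every [l]. *)
have bad l : exists B : set T, [/\ measurable B, (P B <= (delta / s%:R)%:E)%E &
    forall n w, (l < s)%N -> N n -> ~ D n w ->
      (M_B (2^-1 - `|2^-1 - x n w| + eps - n%:R * eps / (maxn n (m l.+1))%:R)%R
           (2^-1 - `|2^-1 - x n w| + eps)%R
     <= ((m l.+1)%:R^-1 * ln (delta / (2 * s%:R)))%:E)%E -> B w].
  have [ls|sl] := ltnP l s; last first.
    exists set0; split => //; rewrite measure0 lee_fin divr_ge0//; exact: ltW.
  have ml : (0 < m l.+1)%N by apply: m_gt0; rewrite ls.
  have [B1 [mB1 PB1 H1]] := deviation_event Xind X_bounded X_mean mu01
    eps_bounds false ml A1.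
  have [B2 [mB2 PB2 H2]] := deviation_event Xind X_bounded X_mean mu01
    eps_bounds true ml A1.
  exists (B1 `|` B2); split; first exact: measurableU.
    apply: le_trans (measureU2 P mB1 mB2) _.
    apply: le_trans (leeD PB1 PB2) _; rewrite -EFinD lee_fin.
    rewrite le_eqVlt; apply/predU1P; left.
    by rewrite /A; field; rewrite !gt_eqF.
  move=> n w _ Nn /negP; rewrite -leNgt => dev stop.
  rewrite lnA mulrN in stop.
  have n0 := N_gt0 _ Nn.
  have [xmu|xmu] := leP (x n w) mu.
    left; apply: (H1 n w) => //=.
    by move: dev; rewrite ler0_norm ?subr_le0// /reflect_if /x; lra.
  right; apply: (H2 n w) => //=.
  by move: dev; rewrite gtr0_norm ?subr_gt0// /reflect_if /x; lra.
have {bad} [B HB] := choice bad.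
pose U := \big[setU/set0]_(l < s) B l.
have mB l : measurable (B l) by have [] := HB l.
have mU : measurable U by exact: bigsetU_measurable.
have PU : (P U <= delta%:E)%E.
  apply: le_trans (Boole_inequality P (fun l _ => mB l)) _.
  apply: (@le_trans _ _ (\sum_(l < s) (delta / s%:R)%:E)%E).
    by apply: lee_sum => l _; have [] := HB l.
  rewrite sumEFin lee_fin sumr_const card_ord -[leLHS]mulr_natr.
  by rewrite divfK ?gt_eqF.
(* Outside [U] sampling terminates by time [m s], and stopping with an error of at least [eps] would
   put [w] in some [B l]. *)
apply: (@le_trans _ _ (P (~` U))).
  by rewrite probability_setC// EFinB leeB.
apply: le_measure; rewrite ?inE//; first exact: measurableC.
move=> w Uw.
have ms0 : (1 <= s <= s)%N by rewrite s_gt0 leqnn.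
have Ems : exists n, `[< N n /\ S n w >].
  exists (m s); apply/asboolP; split; first exact: m_in_N.
  by apply: stopping_condition_last => //; exact: m_gt0.
case: (ex_minnP Ems) => n /asboolP[Nn Sn] minn.
exists n.
  by split => // k Nk Sk; apply: minn; exact/asboolP.
apply: contrapT => nD; case: (Sn) => -[|l]// /andP[_ ls] stop.
apply: Uw; rewrite /U -bigcup_mkord; exists l => //.
by have [_ _] := HB l; apply; [exact: ls|exact: Nn|exact: nD|exact: stop].
Qed.
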